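(* Let $\varrho=\frac12\delta_{-1}+\frac12\delta_1$ and $0<\beta<1$. Then there is a constant $C$, depending on $\beta$ only, such that for all $n\ge 1$ $$\sup_{z\in\mathbb{R}}\Big|P_n\big(S_n/\sqrt n\le z\big)-\Phi_\beta(z)\Big|\le C\,n^{-1/2},$$ where $\Phi_\beta$ denotes the distribution function of the normal distribution with expectation zero and variance $(1-\beta)^{-1}$.
   Context: Classical Curie–Weiss model: for $\beta>0$ and $n\ge1$, $P_n=P_{n,\beta}$ is the probability measure on $\{-1,+1\}^n$ under which the spins $(X_1,\dots,X_n)$ have the law $$dP_{n,\beta}(x)=\frac{1}{Z_n(\beta)}\exp\Big(\frac{\beta}{2n}\big(\sum_{i=1}^n x_i\big)^2\Big)\prod_{i=1}^n d\varrho(x_i),$$ with normalizing constant $Z_n(\beta)$. $S_n=\sum_{i=1}^n X_i$. *)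

(* Defs.v *)
From HB Require Import structures.
From mathcomp Require Import all_boot all_order all_algebra.
From mathcomp Require Import all_classical all_reals all_analysis.
From mathcomp Require Import measurable_realfun.

Set Implicit Arguments.
Unset Strict Implicit.
Unset Printing Implicit Defensive.

Import Order.TTheory GRing.Theory Num.Theory.
Import numFieldNormedType.Exports.

Local Open Scope classical_set_scope.
Local Open Scope ring_scope.
Local Open Scope ereal_scope.

Section product_power.
Context d (T : measurableType d) (R : realType).

Definition tuple_cons n (x : T * n.-tuple T) : n.+1.-tuple T :=
  [tuple of x.1 :: x.2].

Lemma measurable_tuple_cons n : measurable_fun [set: T * n.-tuple T]
  (@tuple_cons n).
Proof. exact: measurable_cons. Qed.

HB.instance Definition _ n :=
  isMeasurableFun.Build _ _ _ _ (@tuple_cons n) (@measurable_tuple_cons n).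

(* P^{(x) n}, the law of n independent P-distributed coordinates, obtained by
   transporting P (x) P^{(x) n} along T * T^n ~ T^(n+1). *)
Fixpoint power_prob (P : probability T R) n : probability (n.-tuple T) R :=
  match n with
  | 0 => \d_([tuple] : 0.-tuple T)
  | m.+1 => distribution (P \x power_prob P m) (@tuple_cons m)
  end.

Lemma ge0_integral_power_probS (P : probability T R) n
    (f : n.+1.-tuple T -> \bar R) :
  measurable_fun [set: n.+1.-tuple T] f -> (forall x, 0 <= f x) ->
  \int[power_prob P n.+1]_x f x =
  \int[P]_x \int[power_prob P n]_y f (tuple_cons (x, y)).
Proof.
move=> mf f0; rewrite ge0_integral_distribution//= fubini_tonelli1//=.
by apply: measurableT_comp => //; exact: measurable_tuple_cons.
Qed.

End product_power.

Section rademacher.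
Context (R : realType).

Definition rademacher : set R -> \bar R :=
  measure_add (mscale (2^-1)%:nng%R \d_(-1 : R)%R)
              (mscale (2^-1)%:nng%R \d_(1 : R)%R).

HB.instance Definition _ := Measure.on rademacher.

Let rademacher_setT : rademacher setT = 1.
Proof.
rewrite /rademacher measure_addE /= /mscale /= !diracT !mule1 -EFinD.
by congr EFin; rewrite -div1r -splitr.
Qed.

HB.instance Definition _ :=
  Measure_isProbability.Build _ _ _ rademacher rademacher_setT.

Lemma ge0_integral_rademacher (f : R -> \bar R) :
  measurable_fun [set: R] f -> (forall x, 0 <= f x) ->
  \int[rademacher]_x f x = (2^-1)%:E * f (- 1)%R + (2^-1)%:E * f 1%R.
Proof.
move=> mf f0; rewrite ge0_integral_measure_add//.
by rewrite !ge0_integral_mscale//= !integral_dirac//= !diracT !mul1e.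
Qed.

Lemma power_rademacher_integral_lty n (f : n.-tuple R -> R) :
  measurable_fun [set: n.-tuple R] f -> (forall x, (0 <= f x)%R) ->
  \int[power_prob rademacher n]_x (f x)%:E < +oo.
Proof.
elim: n f => [|n IH] f mf f0.
  rewrite /= integral_dirac//= ?diracT ?mul1e ?ltry//.
  exact/measurable_EFinP.
have mEf : measurable_fun [set: n.+1.-tuple R] (EFin \o f).
  exact/measurable_EFinP.
have mg : measurable_fun [set: R * n.-tuple R]
    (fun z => (f (tuple_cons z))%:E).
  apply: (measurableT_comp mEf); exact: measurable_tuple_cons.
rewrite (ge0_integral_power_probS _ mEf); last by move=> x; rewrite lee_fin.
rewrite ge0_integral_rademacher//; first last.
- by move=> x; apply: integral_ge0 => y _; rewrite lee_fin.
- have := @measurable_fun_fubini_tonelli_F _ _ _ _ _ (power_prob rademacher n)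
    _ mg.
  by apply => z /=; rewrite lee_fin.
have fin x : \int[power_prob rademacher n]_y (f (tuple_cons (x, y)))%:E < +oo.
  apply: (IH (fun y => f (tuple_cons (x, y)))) => [|y]; last exact: f0.
  apply: (measurableT_comp (f := fun z => f (tuple_cons z)) (g := pair x)).
    by apply: measurableT_comp => //; exact: measurable_tuple_cons.
  exact: pair1_measurable.
by apply: lte_add_pinfty; apply: lte_mul_pinfty => //=; rewrite lee_fin invr_ge0.
Qed.

End rademacher.
Arguments rademacher {R}.

Section curie_weiss.
Context (R : realType).
Implicit Types (beta : R) (n : nat).

Definition total_spin n (x : n.-tuple R) : R := (\sum_(i < n) tnth x i)%R.

Lemma measurable_total_spin n : measurable_fun [set: n.-tuple R]
  (@total_spin n).
Proof.
by apply: measurable_sum => i; exact: measurable_tnth.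
Qed.

Definition gibbs_density beta n (x : n.-tuple R) : R :=
  expR (beta / (2 * n%:R) * total_spin x ^+ 2).

Lemma measurable_gibbs_density beta n : measurable_fun [set: n.-tuple R]
  (@gibbs_density beta n).
Proof.
apply: measurableT_comp => //; apply: measurable_funM => //.
apply: measurable_funX; exact: measurable_total_spin.
Qed.

Definition partition_function beta n : R :=
  fine (\int[power_prob rademacher n]_x (gibbs_density beta x)%:E).

Definition curie_weiss beta n (A : set (n.-tuple R)) : \bar R :=
  ((partition_function beta n)^-1)%:E *
  \int[power_prob rademacher n]_(x in A) (gibbs_density beta x)%:E.

Lemma partition_functionE beta n : (partition_function beta n)%:E =
  \int[power_prob rademacher n]_x (gibbs_density beta x)%:E.
Proof.
rewrite fineK// ge0_fin_numE.
  apply: power_rademacher_integral_lty => [|x]; last exact: expR_ge0.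
  exact: measurable_gibbs_density.
by apply: integral_ge0 => x _; rewrite lee_fin expR_ge0.
Qed.

Lemma partition_function_gt0 beta n : (0 < partition_function beta n)%R.
Proof.
rewrite -lte_fin partition_functionE lt0e integral_ge0 ?andbT; last first.
  by move=> x _; rewrite lee_fin expR_ge0.
apply/eqP => int0.
have : \int[power_prob rademacher n]_x `|(gibbs_density beta x)%:E| = 0.
  by rewrite -[RHS]int0; apply: eq_integral => x _; rewrite gee0_abs ?lee_fin ?expR_ge0.
have mE : measurable_fun [set: n.-tuple R] (EFin \o @gibbs_density beta n).
  by apply/measurable_EFinP; exact: measurable_gibbs_density.
move=> /(ae_eq_integral_abs _ measurableT mE)[N [mN N0 sN]].
have NT : N = setT.
  rewrite -subTset => x _; apply: sN => /= /(_ I) [] /eqP.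
  by rewrite gt_eqF// expR_gt0.
have /eqP : (1 : \bar R) = 0.
  by rewrite -(probability_setT (power_prob rademacher n)) -[RHS]N0 NT.
by rewrite onee_eq0.
Qed.

Section curie_weiss_probability.
Variables (beta : R) (n : nat).
Local Notation P := (@curie_weiss beta n).

Let P0 : P set0 = 0.
Proof. by rewrite /curie_weiss integral_set0 mule0. Qed.

Let P_ge0 A : 0 <= P A.
Proof.
apply: mule_ge0; first by rewrite lee_fin invr_ge0 ltW// partition_function_gt0.
by apply: integral_ge0 => x _; rewrite lee_fin expR_ge0.
Qed.

Let P_sigma_additive : semi_sigma_additive P.
Proof.
move=> F mF tF mUF.
have int_ge0 i :
    0 <= \int[power_prob rademacher n]_(x in F i) (gibbs_density beta x)%:E.
  by apply: integral_ge0 => x _; rewrite lee_fin expR_ge0.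
rewrite [X in X @ _ --> _](_ : _ = (fun N =>
  ((partition_function beta n)^-1)%:E * \sum_(0 <= i < N)
  \int[power_prob rademacher n]_(x in F i) (gibbs_density beta x)%:E)); last first.
  by apply/funext => N; rewrite ge0_sume_distrr.
apply: cvgeZl => //.
rewrite ge0_integral_bigcup//=.
- exact: is_cvg_ereal_nneg_natsum.
- apply/measurable_funTS/measurable_EFinP; exact: measurable_gibbs_density.
- by move=> x _; rewrite lee_fin expR_ge0.
Qed.

HB.instance Definition _ := isMeasure.Build _ _ _ P P0 P_ge0 P_sigma_additive.

Let P_setT : P setT = 1.
Proof.
by rewrite /curie_weiss -partition_functionE -EFinM mulVf// gt_eqF//
  partition_function_gt0.
Qed.

HB.instance Definition _ := Measure_isProbability.Build _ _ _ P P_setT.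

End curie_weiss_probability.

Definition spins n : set (n.-tuple R) :=
  [set x | forall i, tnth x i = (- 1)%R \/ tnth x i = 1%R].
Arguments spins : clear implicits.

Lemma measurable_spins n : measurable (spins n).
Proof.
rewrite (_ : spins n = \bigcap_(i in [set: 'I_n])
    ((fun x : n.-tuple R => tnth x i) @^-1` ([set (- 1)%R] `|` [set 1%R]))).
  apply: fin_bigcap_measurable => // i _; rewrite -[X in measurable X]setTI.
  by apply: measurable_tnth => //; exact: measurableU.
by apply/seteqP; split=> [x xs i _|x xs i]; [exact: xs|exact: (xs i)].
Qed.

Lemma power_rademacher_spins n : power_prob (@rademacher R) n (spins n) = 1.
Proof.
elim: n => [|n IH].
  by rewrite /= diracE mem_set// => -[].
have mS := @measurable_spins n.+1.
transitivity (\int[power_prob (@rademacher R) n.+1]_x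
    (\1_(spins n.+1) x)%:E : \bar R).
  by rewrite integral_indic// setIT.
have m1 : measurable_fun [set: n.+1.-tuple R]
    (EFin \o (\1_(spins n.+1) : n.+1.-tuple R -> R)).
  by apply/measurable_EFinP; exact: measurable_indic.
rewrite (ge0_integral_power_probS _ m1)//=.
have E (x : R) : x = (- 1)%R \/ x = 1%R ->
    \int[power_prob rademacher n]_y (\1_(spins n.+1) (tuple_cons (x, y)))%:E
    = 1 :> \bar R.
  move=> hx; transitivity (\int[power_prob (@rademacher R) n]_y
      (\1_(spins n) y)%:E : \bar R); last first.
    by rewrite integral_indic// ?setIT//; exact: measurable_spins.
  apply: eq_integral => y _; congr EFin; rewrite !indicE; congr (_%:R).
  congr nat_of_bool; apply/idP/idP => /set_mem h; apply/mem_set => i.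
    by have := h (lift ord0 i); rewrite tnthS.
  have [->//|i0] := eqVneq i ord0.
  by case: (unliftP ord0 i) i0 => [j ->|->]; rewrite ?eqxx// tnthS.
rewrite ge0_integral_rademacher.
- by rewrite !E; [rewrite !mule1 -EFinD -div1r -splitr|right|left].
- have := @measurable_fun_fubini_tonelli_F _ _ _ _ _ (power_prob rademacher n)
    (fun z => (\1_(spins n.+1) (tuple_cons z))%:E).
  apply => //.
  apply: (measurableT_comp m1).
  exact: measurable_tuple_cons.
- by move=> x; apply: integral_ge0.
Qed.

(* The ambient space of curie_weiss is R^n; all its mass is on {-1, 1}^n. *)
Lemma curie_weiss_spins beta n : curie_weiss beta (spins n) = 1.
Proof.
have mS := @measurable_spins n.
have mE : measurable_fun [set: n.-tuple R] (EFin \o @gibbs_density beta n).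
  by apply/measurable_EFinP; exact: measurable_gibbs_density.
have SC : power_prob (@rademacher R) n (~` spins n) = 0.
  by rewrite probability_setC// power_rademacher_spins subee.
have C0 : curie_weiss beta (~` spins n) = 0.
  rewrite /curie_weiss (_ : integral _ _ _ = 0) ?mule0//.
  apply: null_set_integral => //; first exact: measurableC.
  exact: measurable_funTS.
have := probability_setC (curie_weiss beta (n := n)) (measurableC mS).
by rewrite setCK => h; apply: (etrans h); rewrite -[RHS]sube0 -C0.
Qed.

(* v is the variance; normal_prob takes the standard deviation. *)
Definition normal_cdf (v z : R) : \bar R :=
  normal_prob 0 (Num.sqrt v) `]-oo, z].

End curie_weiss.

(* Main.v *)
Require Import Defs.
From HB Require Import structures.
From mathcomp Require Import all_boot all_order all_algebra.
From mathcomp Require Import all_classical all_reals all_analysis.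
From mathcomp Require Import measurable_realfun.
From mathcomp Require Import ring lra zify.

Set Implicit Arguments.
Unset Strict Implicit.
Unset Printing Implicit Defensive.

Import Order.TTheory GRing.Theory Num.Theory.
Import numFieldNormedType.Exports.

Local Open Scope classical_set_scope.
Local Open Scope ring_scope.
Local Open Scope ereal_scope.

(** The spin configurations with [j] coordinates equal to [1] have total spin
    [k = 2j - n], so under the Curie-Weiss measure the total spin takes this
    value with probability proportional to [w_j = 'C(n, j) exp (beta k^2 / 2n)]
    ([integral_total_spin], [curie_weiss_cdf]).  Put [a = 1 - beta],
    [x_j = k / sqrt n] and [b_j = 'C(n, j) exp (k^2 / 2n)].  Then
    [w_j = b_j exp (- a x_j^2 / 2)], and the point is that [b_j] is nearly
    constant in [j]: with [t = (k + 1) / (n + 1)],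
    [b_(j+1) / b_j = (1 - t) / (1 + t) exp (2 (k + 1) / n)], which is
    [1 + O(k / n^2 + t^3)].  Multiplying these ratios outwards from the centre
    [j = n/2], where [b_j] is called [b], gives
    [|b_j - b| <= b O(x_j^2 + x_j^4) / n] for all [j]
    ([binom_profile_near]).  The Gaussian factor absorbs the powers of [x_j],
    uniformly in [j]; this is where [beta < 1] enters.

    Hence [w_j], multiplied by [2 p / (b sqrt n)] with [p] the maximum of the
    normal density, differs from the term of a midpoint Riemann sum
    of the normal density by [O(n^(-3/2))].  The midpoint rule on a cell of width [2 / sqrt n] also has an error [O(n^(-3/2))], because the
    second derivative of the density is bounded ([midpoint_rule],
    [Phi_midpoint]).  There are only [n + 1] cells, so these uniform errors add
    up to [O(n^(-1/2))] over any initial run of cells ([scaled_weight_sum]); neither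
    decay in [x_j] nor Stirling's formula is involved.

    The cells cover an interval reaching beyond [- sqrt n] and [sqrt n], outside
    which the normal law has mass [O(1/n)].  So the scaled weights have total
    mass [1 + O(n^(-1/2))], and dividing by this total, which produces the
    Curie-Weiss probabilities, changes partial sums by [O(n^(-1/2))] only.
    Replacing the end of the last cell by the threshold [z] costs another cell
    width times the maximal density ([Phi_threshold], [weight_ratio_Phi]). *)

(** * The midpoint rule *)

Section midpoint_rule.
Context {R : realType}.
Local Open Scope ring_scope.
Implicit Types (F f df : R -> R) (x u v h L : R).

Lemma mean_value f df u v : (forall x, is_derive x 1 f (df x)) -> u <= v ->
  exists2 c, u <= c <= v & f v - f u = df c * (v - u).
Proof.
move=> fdf uv; have [|c cuv ->] := @MVT_segment R f df u v uv (fun x _ => fdf x).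
  apply: continuous_subspaceT => x.
  by apply: differentiable_continuous; apply/derivable1_diffP; case: (fdf x).
by exists c.
Qed.

Lemma derive_bound_lipschitz f df L : (forall x, is_derive x 1 f (df x)) ->
  (forall x, `|df x| <= L) ->
  forall u v, u <= v -> `|f v - f u| <= L * (v - u).
Proof.
move=> fdf dfL u v uv; have [c _ ->] := mean_value fdf uv.
by rewrite normrM [X in _ * X]ger0_norm ?subr_ge0// ler_wpM2r ?subr_ge0.
Qed.

(** The two increments are values of [f'] times [h], at points at most [2h]
    apart. *)
Lemma symmetric_difference_bound f f1 f2 L :
  (forall x, is_derive x 1 f (f1 x)) -> (forall x, is_derive x 1 f1 (f2 x)) ->
  (forall x, `|f2 x| <= L) ->
  forall x h, 0 <= h -> `|f (x + h) + f (x - h) - 2 * f x| <= 2 * L * h ^+ 2.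
Proof.
move=> ff1 f1f2 f2L x h h0.
have L0 : 0 <= L by apply: le_trans (f2L 0).
have [|c /andP[xc cxh] Ec] := @mean_value f f1 x (x + h) ff1.
  by rewrite lerDl.
have [|d /andP[xd dxh] Ed] := @mean_value f f1 (x - h) x ff1.
  by rewrite gerBl.
have -> : f (x + h) + f (x - h) - 2 * f x = (f1 c - f1 d) * h.
  have -> : f (x + h) = f x + f1 c * h.
    by move: Ec; rewrite addrAC subrr add0r; lra.
  have -> : f (x - h) = f x - f1 d * h.
    by move: Ed; rewrite subKr; lra.
  ring.
have := derive_bound_lipschitz f1f2 f2L (le_trans dxh xc) => cd.
rewrite normrM (ger0_norm h0) expr2 mulrA ler_wpM2r//.
apply: (le_trans cd); rewrite [2 * L]mulrC -mulrA ler_wpM2l//; lra.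
Qed.

(** As a function of [h], the error vanishes at [0] and its derivative is the
    symmetric second difference of [f], hence [O(h^2)]; one mean value step then
    makes the error cubic. *)
Lemma midpoint_rule F f f1 f2 L :
  (forall x, is_derive x 1 F (f x)) ->
  (forall x, is_derive x 1 f (f1 x)) -> (forall x, is_derive x 1 f1 (f2 x)) ->
  (forall x, `|f2 x| <= L) ->
  forall x h, 0 <= h -> `|F (x + h) - F (x - h) - 2 * h * f x| <= 2 * L * h ^+ 3.
Proof.
move=> Ff ff1 f1f2 f2L x h h0.
pose H (s : R) : R := F (x + s) - F (x - s) - 2 * s * f x.
have dH (s : R) : is_derive s 1 H (f (x + s) + f (x - s) - 2 * f x).
  have d1 : is_derive s 1 (F \o (fun s : R => x + s)) (f (x + s) * 1).
    apply: (@is_derive1_comp R F (fun s => x + s) s _ _ (Ff _)).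
    by have := is_deriveD (is_derive_cst x s 1) (is_derive_id s 1); rewrite add0r.
  have d2 : is_derive s 1 (F \o (fun s : R => x - s)) (f (x - s) * -1).
    apply: (@is_derive1_comp R F (fun s => x - s) s _ _ (Ff _)).
    by have := is_deriveB (is_derive_cst x s 1) (is_derive_id s 1); rewrite sub0r.
  have d3 : is_derive s 1 (fun s : R => 2 * s * f x) (2 * f x).
    apply: is_derive_eq; rewrite /GRing.scale/=; ring.
  by have := is_deriveB (is_deriveB d1 d2) d3; rewrite mulr1 mulrN1 opprK.
have [c /andP[c0 ch] Ec] := mean_value dH h0.
have H0 : H 0 = 0 by rewrite /H addr0 !subr0 subrr mulr0 mul0r subrr.
rewrite -/(H h); move: Ec; rewrite H0 !subr0 => ->.
rewrite normrM (ger0_norm h0) exprSr mulrA ler_wpM2r//.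
apply: le_trans (symmetric_difference_bound ff1 f1f2 f2L x c0) _.
have L0 : 0 <= L by apply: le_trans (f2L 0).
by rewrite ler_wpM2l ?mulr_ge0// lerXn2r.
Qed.

End midpoint_rule.

(** * The Gaussian density and its distribution function *)

Section gaussian.
Context {R : realType}.
Local Open Scope ring_scope.
Implicit Types a u v x y z h U : R.

Lemma mul_expRN_le1 u : u * expR (- u) <= 1.
Proof.
rewrite expRN ler_pdivrMr ?expR_gt0// mul1r.
by apply: le_trans (expR_ge1Dx u); rewrite lerDr.
Qed.

Definition gauss a x : R := expR (- (a / 2 * x ^+ 2)).

Lemma gauss_gt0 a x : 0 < gauss a x. Proof. exact: expR_gt0. Qed.

Lemma gauss_le1 a x : 0 < a -> gauss a x <= 1.
Proof.
move=> a0; rewrite /gauss expR_le1 oppr_le0 mulr_ge0 ?sqr_ge0//.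
by rewrite divr_ge0// ltW.
Qed.

Lemma sqr_mul_gauss_le a x : 0 < a -> x ^+ 2 * gauss a x <= 2 / a.
Proof.
move=> a0; have := mul_expRN_le1 (a / 2 * x ^+ 2).
by rewrite -/(gauss a x) ler_pdivlMr//; lra.
Qed.

(** The quadratic bound for [gauss (a / 2)], squared. *)
Lemma pow4_mul_gauss_le a x : 0 < a -> x ^+ 4 * gauss a x <= 16 / a ^+ 2.
Proof.
move=> a0.
have gE : gauss a x = gauss (a / 2) x ^+ 2.
  by rewrite /gauss -expRM_natl; congr expR; field.
have -> : x ^+ 4 * gauss a x = (x ^+ 2 * gauss (a / 2) x) ^+ 2 by rewrite gE; ring.
have -> : 16 / a ^+ 2 = (2 / (a / 2)) ^+ 2 by field; rewrite gt_eqF.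
have a20 : 0 < a / 2 by rewrite divr_gt0.
rewrite lerXn2r ?sqr_mul_gauss_le//; rewrite nnegrE.
  by rewrite mulr_ge0 ?sqr_ge0// expR_ge0.
by rewrite divr_ge0// ltW.
Qed.

Lemma is_derive_gauss a x : is_derive x 1 (gauss a) (- (a * x) * gauss a x).
Proof.
have d : is_derive x 1 (fun x : R => - (a / 2 * x ^+ 2)) (- (a * x)).
  apply: is_derive_eq; by rewrite /GRing.scale/=; field.
rewrite mulrC.
exact: (@is_derive1_comp R expR (fun x => - (a / 2 * x ^+ 2)) x _ _ _ d).
Qed.

Lemma is_derive2_gauss a x : is_derive x 1 (fun x => - (a * x) * gauss a x)
  ((a ^+ 2 * x ^+ 2 - a) * gauss a x).
Proof.
have d : is_derive x 1 (fun x : R => - (a * x)) (- a).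
  apply: is_derive_eq; rewrite /GRing.scale/=; ring.
have := is_deriveM d (is_derive_gauss a x).
rewrite /GRing.scale/= => dd; apply: is_derive_eq dd _; ring.
Qed.

Lemma gauss_derive2_bound a x : 0 < a ->
  `|(a ^+ 2 * x ^+ 2 - a) * gauss a x| <= 2 * a.
Proof.
move=> a0; have := sqr_mul_gauss_le x a0.
rewrite ler_pdivlMr// => xg.
have g1 := gauss_le1 x a0.
have g0 := gauss_gt0 a x.
have p0 : 0 <= x ^+ 2 * gauss a x * a.
  by rewrite (mulr_ge0 (mulr_ge0 (sqr_ge0 _) _)) ?ltW.
rewrite ler_norml.
have -> : (a ^+ 2 * x ^+ 2 - a) * gauss a x =
  a * (x ^+ 2 * gauss a x * a - gauss a x) by ring.
by rewrite [2 * a]mulrC -mulrN !ler_pM2l//; lra.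
Qed.

(** The normalizing constant of [gauss a]. *)
Definition peak a : R := normal_peak (Num.sqrt a^-1).

Lemma sqrt_inv_neq0 a : 0 < a -> Num.sqrt a^-1 != 0.
Proof. by move=> a0; rewrite gt_eqF// sqrtr_gt0 invr_gt0. Qed.

Lemma peak_gt0 a : 0 < a -> 0 < peak a.
Proof. by move=> a0; rewrite normal_peak_gt0// sqrt_inv_neq0. Qed.

Lemma normal_pdf_gauss a x : 0 < a ->
  normal_pdf 0 (Num.sqrt a^-1) x = peak a * gauss a x.
Proof.
move=> a0; rewrite normal_pdfE ?sqrt_inv_neq0//; congr (_ * _).
rewrite /normal_fun /gauss subr0 sqr_sqrtr ?invr_ge0 ?ltW//; congr expR.
by rewrite -[_ *+ 2]mulr_natr; field; rewrite gt_eqF.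
Qed.

(** A real-valued form of the normal distribution function of variance [1 / a],
    to which the differential calculus applies. *)
Definition Phi a y : R := fine (normal_cdf a^-1 y).

Lemma normal_cdfE a y : normal_cdf a^-1 y = (Phi a y)%:E.
Proof.
rewrite fineK// ge0_fin_numE; last exact: measure_ge0.
exact: le_lt_trans (probability_le1 _ _) (ltry _).
Qed.

Lemma is_derive_Phi a y : 0 < a -> is_derive y 1 (Phi a) (peak a * gauss a y).
Proof.
move=> a0; have y1 : y < y + 1 by rewrite ltrDl.
pose f := normal_pdf 0 (Num.sqrt a^-1).
have fi : lebesgue_measure.-integrable [set` `]-oo, y + 1]] (EFin \o f).
  by apply: (integrableS _ _ (subsetT _)) => //; exact: integrable_normal_pdf.
have cf : {for y, continuous f}.
  by apply: continuous_normal_pdf; rewrite sqrt_inv_neq0.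
have [dF] := continuous_FTC1 y1 fi (ltNyr y) cf.
by rewrite derive1E /f normal_pdf_gauss// => <-.
Qed.

Lemma Phi_lipschitz a u v : 0 < a -> u <= v -> `|Phi a v - Phi a u| <= peak a * (v - u).
Proof.
move=> a0; apply: derive_bound_lipschitz => [x|x]; first exact: is_derive_Phi.
have p0 := peak_gt0 a0; have g0 := gauss_gt0 a x.
by rewrite gtr0_norm ?mulr_gt0// ger_pMr// gauss_le1.
Qed.

Lemma Phi_midpoint a x h : 0 < a -> 0 <= h ->
  `|Phi a (x + h) - Phi a (x - h) - 2 * h * (peak a * gauss a x)|
    <= 4 * a * peak a * h ^+ 3.
Proof.
move=> a0 h0; have p0 := peak_gt0 a0.
have -> : 4 * a * peak a * h ^+ 3 = 2 * (peak a * (2 * a)) * h ^+ 3 by ring.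
apply: (@midpoint_rule _ (Phi a) (fun x => peak a * gauss a x)
  (fun x => peak a * (- (a * x) * gauss a x))
  (fun x => peak a * ((a ^+ 2 * x ^+ 2 - a) * gauss a x))) => //.
- by move=> y; exact: is_derive_Phi.
- by move=> y; exact: (is_deriveZ (peak a) (is_derive_gauss a y)).
- by move=> y; exact: (is_deriveZ (peak a) (is_derive2_gauss a y)).
- by move=> y; rewrite normrM gtr0_norm// ler_pM2l// gauss_derive2_bound.
Qed.

Lemma Phi_ge0 a y : 0 <= Phi a y.
Proof. by apply: fine_ge0; exact: measure_ge0. Qed.

Lemma Phi_le1 a y : Phi a y <= 1.
Proof. by rewrite -lee_fin -normal_cdfE; exact: probability_le1. Qed.

Lemma Phi_le a u v : u <= v -> Phi a u <= Phi a v.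
Proof.
move=> uv; rewrite -lee_fin -!normal_cdfE.
by apply: le_measure; rewrite ?inE//; apply: subset_itvl; rewrite bnd_simp.
Qed.

(** Half of the exponent is turned into a normal density of twice the variance,
    of total mass [1]; the other half is at most [(4 / a) / U^2] outside
    [- U, U]. *)
Lemma normal_prob_tail a U (A : set R) : 0 < a -> 0 < U -> measurable A ->
  (forall x, A x -> U <= `|x|) ->
  (normal_prob 0 (Num.sqrt a^-1) A <=
    (peak a / peak (a / 2) * (4 / a) / U ^+ 2)%:E)%E.
Proof.
move=> a0 U0 mA AU.
have a20 : 0 < a / 2 by rewrite divr_gt0.
have p2 := peak_gt0 a20.
pose K := peak a / peak (a / 2) * (4 / a) / U ^+ 2.
have K0 : 0 <= K by rewrite !(mulr_ge0, invr_ge0)// ltW// ?peak_gt0.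
have pdfle x : A x -> normal_pdf 0 (Num.sqrt a^-1) x
    <= K * normal_pdf 0 (Num.sqrt (a / 2)^-1) x.
  move=> Ax; rewrite !normal_pdf_gauss// /K.
  have -> : gauss a x = gauss (a / 2) x ^+ 2.
    by rewrite /gauss -expRM_natl; congr expR; field.
  have gx : gauss (a / 2) x <= 4 / a / U ^+ 2.
    rewrite ler_pdivlMr ?exprn_gt0//.
    have := sqr_mul_gauss_le x a20; rewrite invf_div mulrA -natrM => gx.
    apply: le_trans gx; rewrite mulrC ler_pM2r ?gauss_gt0//.
    by rewrite -[leRHS]real_normK ?num_real// lerXn2r ?nnegrE ?(ltW U0)// AU.
  have -> : peak a / peak (a / 2) * (4 / a) / U ^+ 2 *
      (peak (a / 2) * gauss (a / 2) x) =
    peak a * ((4 / a / U ^+ 2) * gauss (a / 2) x).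
    by field; rewrite !gt_eqF.
  by rewrite ler_pM2l ?peak_gt0// expr2 ler_wpM2r// ltW// gauss_gt0.
have mp s : measurable_fun A (fun x : R => (normal_pdf 0 s x)%:E).
  by apply/measurable_EFinP; apply: measurable_funTS; exact: measurable_normal_pdf.
rewrite /normal_prob -/K.
apply: (@le_trans _ _ (\int[lebesgue_measure]_(x in A)
   (K%:E * (normal_pdf 0 (Num.sqrt (a / 2)^-1) x)%:E)))%E.
  apply: ge0_le_integral => //.
  - by move=> x _; rewrite lee_fin normal_pdf_ge0.
  - exact: mp.
  - apply: emeasurable_funM; [exact: measurable_cst|exact: mp].
rewrite ge0_integralZl//.
- rewrite -[leRHS]mule1 lee_wpmul2l ?lee_fin//.
  exact: (probability_le1 (normal_prob 0 (Num.sqrt (a / 2)^-1)) mA).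
- exact: mp.
- by move=> x _; rewrite lee_fin normal_pdf_ge0.
Qed.

Lemma Phi_lower_tail a U : 0 < a -> 0 < U ->
  Phi a (- U) <= peak a / peak (a / 2) * (4 / a) / U ^+ 2.
Proof.
move=> a0 U0; rewrite -lee_fin -normal_cdfE normal_prob_tail// => x /=.
by rewrite in_itv/= => xU; rewrite ler_normr lerNr xU orbT.
Qed.

Lemma Phi_upper_tail a U : 0 < a -> 0 < U ->
  1 - Phi a U <= peak a / peak (a / 2) * (4 / a) / U ^+ 2.
Proof.
move=> a0 U0; rewrite -lee_fin EFinB -normal_cdfE.
rewrite -(@probability_setC _ _ _ (normal_prob 0 (Num.sqrt a^-1)))//.
rewrite normal_prob_tail//; first exact: measurableC.
move=> x /=; rewrite in_itv/= => /negP; rewrite -ltNge => Ux.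
by rewrite ler_normr ltW.
Qed.

End gaussian.

(** * Binomial coefficients against their Gaussian shape *)

Section binomial_profile.
Context {R : realType}.
Local Open Scope ring_scope.
Implicit Types (t x : R) (n j : nat).

Lemma expR_ge_quadratic x : 0 <= x -> 1 + x + x ^+ 2 / 2 <= expR x.
Proof.
move=> x0; pose G (y : R) : R := expR y - (1 + y + y ^+ 2 / 2).
have dG (y : R) : is_derive y 1 G (expR y - (1 + y)).
  have d : is_derive y 1 (fun y : R => 1 + y + y ^+ 2 / 2) (1 + y).
    apply: is_derive_eq; by rewrite /GRing.scale/=; field.
  exact: is_deriveB.
have [c /andP[c0 _]] := mean_value dG x0.
have -> : G 0 = 0 by rewrite /G expR0; ring.
rewrite !subr0 => Gx; rewrite -subr_ge0 -/(G x) Gx mulr_ge0// subr_ge0.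
exact: expR_ge1Dx.
Qed.

(** Together with [onemx_mul_expR_ge], this says that [(1 - t) / (1 + t)] is
    [exp (- 2 t)] up to a factor [1 + O(t^3)]: the quadratic terms cancel. *)
Lemma onemx_mul_expR_le t : 0 <= t -> (1 - t) * expR (2 * t) <= 1 + t.
Proof.
move=> t0; pose G (y : R) : R := (1 + y) * expR (- (2 * y)) - (1 - y).
have dG (y : R) : is_derive y 1 G (1 - (1 + 2 * y) * expR (- (2 * y))).
  have d0 : is_derive y 1 (fun y : R => - (2 * y)) (- 2).
    by apply: is_derive_eq; rewrite /GRing.scale/=; ring.
  have d1 := @is_derive1_comp R expR (fun y => - (2 * y)) y _ _ (is_derive_expR _) d0.
  have d2 : is_derive y 1 (fun y : R => 1 + y) 1.
    by have := is_deriveD (is_derive_cst (1 : R) y 1) (is_derive_id y 1); rewrite add0r.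
  have d3 : is_derive y 1 (fun y : R => 1 - y) (-1).
    by have := is_deriveB (is_derive_cst (1 : R) y 1) (is_derive_id y 1); rewrite sub0r.
  have d4 := is_deriveB (is_deriveM d2 d1) d3.
  by apply: is_derive_eq d4 _; rewrite /GRing.scale/=; ring.
have [c /andP[c0 _]] := mean_value dG t0.
have -> : G 0 = 0 by rewrite /G mulr0 oppr0 expR0; ring.
rewrite !subr0 => Gt.
have : 0 <= G t.
  rewrite Gt mulr_ge0// subr_ge0 expRN ler_pdivrMr ?expR_gt0// mul1r.
  exact: expR_ge1Dx.
by rewrite /G subr_ge0 expRN ler_pdivlMr ?expR_gt0.
Qed.

Lemma onemx_mul_expR_ge t : 0 <= t <= 1 ->
  (1 + t) * (1 - 2 * t ^+ 3) <= (1 - t) * expR (2 * t).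
Proof.
move=> /andP[t0 t1].
apply: (@le_trans _ _ ((1 - t) * (1 + 2 * t + (2 * t) ^+ 2 / 2))).
  rewrite -subr_ge0.
  have -> : (1 - t) * (1 + 2 * t + (2 * t) ^+ 2 / 2) - (1 + t) * (1 - 2 * t ^+ 3)
    = 2 * t ^+ 4 by field.
  by rewrite mulr_ge0 ?exprn_ge0.
by rewrite ler_wpM2l ?subr_ge0// expR_ge_quadratic// mulr_ge0.
Qed.

(** The total spin of a configuration with [j] spins equal to [1]. *)
Definition spin_at n j : R := 2 * j%:R - n%:R.

(** The binomial coefficient divided by its Gaussian shape [exp (- k^2 / 2n)],
    hence nearly constant in [j]. *)
Definition binom_profile n j : R := 'C(n, j)%:R * expR (spin_at n j ^+ 2 / (2 * n%:R)).

Lemma binom_profile_ge0 n j : 0 <= binom_profile n j.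
Proof. by rewrite mulr_ge0 ?expR_ge0. Qed.

Lemma spin_at_sym n j : (j <= n)%N -> spin_at n (n - j) = - spin_at n j.
Proof. by move=> jn; rewrite /spin_at natrB//; ring. Qed.

Lemma binom_profile_sym n j : (j <= n)%N -> binom_profile n (n - j) = binom_profile n j.
Proof.
by move=> jn; rewrite /binom_profile bin_sub// spin_at_sym// sqrrN.
Qed.

(** The exponents differ by [((k + 2)^2 - k^2) / 2n = 2 (k + 1) / n], and the
    binomial coefficients have ratio [(n - j) / (j + 1)], which is
    [(1 - t) / (1 + t)]. *)
Lemma binom_profile_step n j (t := (spin_at n j + 1) / (n%:R + 1)) :
  (0 < n)%N -> (j <= n)%N ->
  binom_profile n j.+1 * (1 + t) =
    binom_profile n j * ((1 - t) * expR (2 * (spin_at n j + 1) / n%:R)).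
Proof.
move=> n0 jn; have nR : n%:R != 0 :> R by rewrite pnatr_eq0 -lt0n.
have n1 : n%:R + 1 != 0 :> R by rewrite natr1 pnatr_eq0.
have B : j.+1%:R * 'C(n, j.+1)%:R = (n%:R - j%:R) * 'C(n, j)%:R :> R.
  by rewrite -natrB// -!natrM mul_bin_left.
have -> : 1 + t = 2 * j.+1%:R / (n%:R + 1).
  by rewrite /t /spin_at -natr1; field.
have -> : 1 - t = 2 * (n%:R - j%:R) / (n%:R + 1).
  by rewrite /t /spin_at; field.
have -> : binom_profile n j.+1 =
    'C(n, j.+1)%:R * (expR (spin_at n j ^+ 2 / (2 * n%:R))
    * expR (2 * (spin_at n j + 1) / n%:R)).
  rewrite /binom_profile -expRD; congr (_ * expR _).
  by rewrite /spin_at -natr1; field.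
rewrite /binom_profile.
transitivity ((j.+1%:R * 'C(n, j.+1)%:R) * (2 / (n%:R + 1) *
  (expR (spin_at n j ^+ 2 / (2 * n%:R)) * expR (2 * (spin_at n j + 1) / n%:R)))).
  by field.
by rewrite B; field.
Qed.

Section step_bounds.
Variables n j : nat.
Hypotheses (n0 : (0 < n)%N) (jn : (j < n)%N) (nj : (n <= j.*2)%N).
Let N : R := n%:R.
Let t : R := (spin_at n j + 1) / (N + 1).

Let N0 : 0 < N. Proof. by rewrite ltr0n. Qed.

Lemma spin_at_ge0 : 0 <= spin_at n j.
Proof. by rewrite /spin_at subr_ge0 -natrM ler_nat mul2n. Qed.

Let t01 : 0 <= t <= 1.
Proof.
have d0 := spin_at_ge0; have N1 : 0 < N + 1 by rewrite addr_gt0.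
have -> /= : 0 <= t by rewrite divr_ge0 ?(ltW N1)// ler_wpDr.
rewrite ler_pdivrMr ?addr_gt0// mul1r lerD2r /spin_at lerBlDr.
rewrite -natrM -natrD ler_nat; lia.
Qed.

Lemma binom_profile_step_le : binom_profile n j.+1 <=
  binom_profile n j * expR (2 * (spin_at n j + 1) / (N * (N + 1))).
Proof.
have /andP[t0 t1] := t01; have d0 := spin_at_ge0.
have t1' : 0 < 1 + t by lra.
have r0 := binom_profile_ge0 n j.
rewrite -(ler_pM2r t1') (binom_profile_step n0 (ltnW jn)) -/N -/t.
have -> : expR (2 * (spin_at n j + 1) / N) =
    expR (2 * t) * expR (2 * (spin_at n j + 1) / (N * (N + 1))).
  by rewrite -expRD; congr expR; rewrite /t; field; rewrite !gt_eqF ?addr_gt0.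
rewrite -[leRHS]mulrA ler_wpM2l// [leRHS]mulrC mulrA.
by rewrite ler_wpM2r ?expR_ge0// onemx_mul_expR_le.
Qed.

Lemma binom_profile_step_ge :
  binom_profile n j * (1 - 2 * ((spin_at n j + 1) / N) ^+ 3) <= binom_profile n j.+1.
Proof.
have /andP[t0 t1] := t01; have d0 := spin_at_ge0.
have t1' : 0 < 1 + t by lra.
have r0 := binom_profile_ge0 n j.
have tN : t <= (spin_at n j + 1) / N.
  have d1 : 0 <= spin_at n j + 1 by lra.
  by rewrite /t ler_wpM2l// lef_pV2 ?posrE ?addr_gt0//; lra.
rewrite -(ler_pM2r t1') (binom_profile_step n0 (ltnW jn)) -/N -/t.
rewrite -[leLHS]mulrA ler_wpM2l// [leLHS]mulrC.
apply: (@le_trans _ _ ((1 + t) * (1 - 2 * t ^+ 3))).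
  rewrite ler_pM2l// lerD2l lerN2 ler_pM2l// lerXn2r// nnegrE//.
  exact: le_trans tN.
apply: (le_trans (onemx_mul_expR_ge t01)).
rewrite ler_wpM2l ?subr_ge0// ler_expR -mulrA ler_pM2l//.
Qed.

End step_bounds.

(** The steps multiply up: [2 (k + 1) / n^2] and [2 (k + 1)^3 / n^3] are at most
    the increments of [k^2 / n^2] and [k^4 / n^3] when [k] grows by [2]. *)
Lemma binom_profile_bounds n j : (0 < n)%N -> (uphalf n <= j <= n)%N ->
  binom_profile n (uphalf n) * (1 - spin_at n j ^+ 4 / n%:R ^+ 3) <= binom_profile n j
    <= binom_profile n (uphalf n) * expR (spin_at n j ^+ 2 / n%:R ^+ 2).
Proof.
move=> n0 /andP[/subnKC <-]; elim: (j - uphalf n)%N => [|i IH] {j}.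
  move=> _; have r0 := binom_profile_ge0 n (uphalf n); rewrite addn0.
  have N0 : 0 < n%:R :> R by rewrite ltr0n.
  apply/andP; split.
    rewrite ler_piMr// gerBl; apply: divr_ge0; first exact: exprn_even_ge0.
    by rewrite exprn_ge0// ltW.
  rewrite ler_peMr// -[leLHS]expR0 ler_expR divr_ge0 ?sqr_ge0//.
rewrite addnS => jn; have /andP[lb ub] := IH (ltnW jn).
have nj : (n <= (uphalf n + i).*2)%N by have := odd_double_half n; rewrite uphalf_half; lia.
move: {IH} (uphalf n + i)%N lb ub jn nj => j lb ub jn nj.
have := binom_profile_step_le n0 jn nj; have := binom_profile_step_ge n0 jn nj.
have := spin_at_ge0 nj; have : 0 < n%:R :> R by rewrite ltr0n.
have -> : spin_at n j.+1 = spin_at n j + 2 by rewrite /spin_at -natr1; ring.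
have := binom_profile_ge0 n (uphalf n); have := binom_profile_ge0 n j.
have := binom_profile_ge0 n j.+1.
move: lb ub.
move: (binom_profile n (uphalf n)) (binom_profile n j) (binom_profile n j.+1)
  (spin_at n j) (n%:R : R).
move=> r0 r r' k N lb ub r'_ge0 r_ge0 r0_ge0 N0 k0 ge le.
apply/andP; split.
  set u := k ^+ 4 / N ^+ 3 in lb; set v := 2 * ((k + 1) / N) ^+ 3 in ge.
  have u0 : 0 <= u by rewrite divr_ge0 ?exprn_ge0 ?(ltW N0).
  have v0 : 0 <= v by rewrite mulr_ge0 ?exprn_ge0 ?divr_ge0 ?addr_ge0 ?(ltW N0).
  have uvE : u + v <= (k + 2) ^+ 4 / N ^+ 3.
    have -> : u + v = (k ^+ 4 + 2 * (k + 1) ^+ 3) / N ^+ 3.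
      by rewrite /u /v; field; rewrite gt_eqF.
    rewrite ler_pM2r ?invr_gt0 ?exprn_gt0// -subr_ge0.
    have -> : (k + 2) ^+ 4 - (k ^+ 4 + 2 * (k + 1) ^+ 3) =
      6 * k ^+ 3 + 18 * k ^+ 2 + 26 * k + 14 by ring.
    by rewrite !addr_ge0 ?mulr_ge0 ?exprn_ge0.
  apply: (@le_trans _ _ (r0 * (1 - (u + v)))).
    by rewrite ler_wpM2l// lerD2l lerN2.
  (* Beyond [u + v = 1] the lower bound is negative and only positivity is left. *)
  have [uv1|uv1] := leP (u + v) 1; last first.
    apply: le_trans r'_ge0; rewrite mulr_ge0_le0//; lra.
  apply: le_trans ge; apply: (@le_trans _ _ (r0 * (1 - u) * (1 - v))).
    rewrite -mulrA ler_wpM2l//; nra.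
  by rewrite ler_wpM2r//; lra.
apply: (le_trans le).
apply: (@le_trans _ _ (r0 * expR (k ^+ 2 / N ^+ 2) *
    expR (2 * (k + 1) / (N * (N + 1))))).
  by rewrite ler_wpM2r ?expR_ge0.
rewrite -mulrA ler_wpM2l// -expRD ler_expR.
have N1 : 0 < N + 1 by lra.
apply: (@le_trans _ _ (k ^+ 2 / N ^+ 2 + 2 * (k + 1) / N ^+ 2)).
  rewrite lerD2l ler_wpM2l ?mulr_ge0 ?addr_ge0// lef_pV2 ?posrE ?mulr_gt0//.
  by rewrite expr2 ler_pM2l//; lra.
rewrite -mulrDl ler_wpM2r ?invr_ge0 ?sqr_ge0//; nra.
Qed.

(** The left half follows from the right half by the symmetry [k -> - k].  The
    first term is a linear bound for [exp u - 1], valid as [u = k^2 / n^2 <= 1]. *)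
Lemma binom_profile_near n j : (0 < n)%N -> (j <= n)%N ->
  `|binom_profile n j - binom_profile n (uphalf n)| <= binom_profile n (uphalf n) *
    (expR 1 * (spin_at n j ^+ 2 / n%:R ^+ 2) + spin_at n j ^+ 4 / n%:R ^+ 3).
Proof.
move=> n0; wlog nj : j / (uphalf n <= j)%N => [hw|] jn.
  have [|nj] := leqP (uphalf n) j; first by move=> nj; exact: hw.
  have := hw (n - j)%N; rewrite binom_profile_sym//.
  rewrite spin_at_sym//.
  rewrite -[in X in _ -> X](sqrrN (spin_at n j)).
  have -> : (- spin_at n j) ^+ 4 = spin_at n j ^+ 4 by ring.
  apply; last exact: leq_subr.
  have := odd_double_half n; move: nj; rewrite uphalf_half; lia.
have N0 : 0 < n%:R :> R by rewrite ltr0n.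
have njn : (uphalf n <= j <= n)%N by rewrite nj.
have := binom_profile_bounds n0 njn; have := binom_profile_ge0 n (uphalf n).
set r0 := binom_profile n (uphalf n) => r0_ge0.
set u := spin_at n j ^+ 2 / n%:R ^+ 2; set v := _ ^+ 4 / _ => /andP[lb ub].
have u0 : 0 <= u by rewrite divr_ge0 ?sqr_ge0.
have v0 : 0 <= v.
  by apply: divr_ge0; [exact: exprn_even_ge0|rewrite exprn_ge0// ltW].
have u1 : u <= 1.
  rewrite ler_pdivrMr ?exprn_gt0// mul1r -ler_sqrt ?exprn_gt0// !sqrtr_sqr.
  rewrite (gtr0_norm N0) ler_norml /spin_at.
  apply/andP; split; first by have := ler0n R j; lra.
  by have : j%:R <= n%:R :> R by [rewrite ler_nat]; lra.
have eu : expR u <= 1 + expR 1 * u.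
  have : expR u - 1 <= u * expR u.
    have := expR_ge1Dx (- u); rewrite expRN -(ler_pM2l (expR_gt0 u)) divff ?gt_eqF ?expR_gt0//.
    by lra.
  have : expR u <= expR 1 by rewrite ler_expR.
  nra.
have e0 : 0 <= expR 1 * u by rewrite mulr_ge0 ?expR_ge0.
rewrite ler_norml; apply/andP; split; first nra.
nra.
Qed.

End binomial_profile.

(** * Curie-Weiss weights as a Riemann sum *)

Section lattice_comparison.
Context {R : realType}.
Local Open Scope ring_scope.
Implicit Types (beta a x z : R) (n j m : nat).

Definition cw_weight beta n j : R :=
  'C(n, j)%:R * expR (beta / (2 * n%:R) * spin_at n j ^+ 2).

Definition site n j : R := spin_at n j / Num.sqrt n%:R.

Lemma cw_weight_gt0 beta n j : (j <= n)%N -> 0 < cw_weight beta n j.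
Proof. by move=> jn; rewrite mulr_gt0 ?expR_gt0// ltr0n bin_gt0. Qed.

(** The part [1] of [1 - (1 - beta)] in the exponent flattens the binomial
    coefficient; the rest is the limiting normal density. *)
Lemma cw_weightE beta n j : (0 < n)%N ->
  cw_weight beta n j = binom_profile n j * gauss (1 - beta) (site n j).
Proof.
move=> n0; rewrite /cw_weight /binom_profile /gauss -[RHS]mulrA -expRD; congr (_ * expR _).
rewrite /site expr_div_n sqr_sqrtr//; field.
by rewrite pnatr_eq0 -lt0n.
Qed.

(** [2 / a] and [16 / a^2] bound [x^2 gauss a x] and [x^4 gauss a x]. *)
Definition local_const a : R := expR 1 * (2 / a) + 16 / a ^+ 2.

Lemma cw_weight_near beta n j : beta < 1 -> (0 < n)%N -> (j <= n)%N ->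
  `|cw_weight beta n j - binom_profile n (uphalf n) * gauss (1 - beta) (site n j)|
    <= binom_profile n (uphalf n) * (local_const (1 - beta) / n%:R).
Proof.
move=> b1 n0 jn; have a0 : 0 < 1 - beta by rewrite subr_gt0.
have N0 : 0 < n%:R :> R by rewrite ltr0n.
rewrite cw_weightE// -mulrBl normrM [X in _ * X]gtr0_norm ?gauss_gt0//.
have := @binom_profile_near R n j n0 jn; rewrite -(ler_pM2r (gauss_gt0 (1 - beta) (site n j))).
move/le_trans; apply; rewrite -mulrA ler_wpM2l ?binom_profile_ge0//.
have <- : site n j ^+ 2 / n%:R = spin_at n j ^+ 2 / n%:R ^+ 2.
  by rewrite /site expr_div_n sqr_sqrtr//; field; rewrite gt_eqF.
have <- : site n j ^+ 4 / n%:R = spin_at n j ^+ 4 / n%:R ^+ 3.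
  rewrite /site (_ : _ ^+ 4 = (spin_at n j ^+ 2 / Num.sqrt n%:R ^+ 2) ^+ 2).
    by rewrite sqr_sqrtr//; field; rewrite gt_eqF.
  by rewrite -expr_div_n -exprM.
have -> : (expR 1 * (site n j ^+ 2 / n%:R) + site n j ^+ 4 / n%:R) *
    gauss (1 - beta) (site n j) =
  (expR 1 * (site n j ^+ 2 * gauss (1 - beta) (site n j)) +
    site n j ^+ 4 * gauss (1 - beta) (site n j)) / n%:R by ring.
rewrite ler_pM2r ?invr_gt0// lerD ?pow4_mul_gauss_le//.
by rewrite ler_pM2l ?expR_gt0// sqr_mul_gauss_le.
Qed.

Section fixed_size.
Variables (beta : R) (n : nat).
Hypotheses (beta1 : beta < 1) (n_gt0 : (0 < n)%N).
Let a : R := 1 - beta.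
Let h : R := (Num.sqrt n%:R)^-1.

Let a0 : 0 < a. Proof. by rewrite subr_gt0. Qed.
Let N0 : 0 < n%:R :> R. Proof. by rewrite ltr0n. Qed.
Let h0 : 0 < h. Proof. by rewrite invr_gt0 sqrtr_gt0. Qed.
Let hE : h ^+ 2 = n%:R^-1. Proof. by rewrite /h exprVn sqr_sqrtr. Qed.
Let h1 : h <= 1.
Proof.
rewrite invf_le1 ?sqrtr_gt0// -[leLHS]sqrtr1 ler_sqrt//.
by rewrite ler1n.
Qed.

(** The left end of the cell of width [2 / sqrt n] centred at [site n j]. *)
Definition cell j : R := site n j - h.

Lemma cellS j : cell j.+1 = site n j + h.
Proof. by rewrite /cell /site /spin_at -natr1 -/h; ring. Qed.

(** The factor makes these weights the terms of a midpoint Riemann sum of the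
    normal density, so that their total is close to [1] and no asymptotics of the
    partition function is required. *)
Definition scaled_weight j : R :=
  2 * h * peak a / binom_profile n (uphalf n) * cw_weight beta n j.

Lemma binom_profile_center_gt0 : 0 < binom_profile n (uphalf n) :> R.
Proof.
rewrite mulr_gt0 ?expR_gt0// ltr0n bin_gt0 leq_uphalf_double; lia.
Qed.

Definition cell_const : R := 2 * peak a * local_const a + 4 * a * peak a.

Lemma scaled_weight_cell j : (j <= n)%N ->
  `|scaled_weight j - (Phi a (cell j.+1) - Phi a (cell j))| <= cell_const * h ^+ 3.
Proof.
move=> jn; have r0 := binom_profile_center_gt0; have p0 := peak_gt0 a0.
rewrite cellS /cell.
have := Phi_midpoint (site n j) a0 (ltW h0).
have := cw_weight_near beta1 n_gt0 jn; rewrite -/a.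
set A := cw_weight _ _ _; set G := gauss _ _; set D := Phi _ _ - Phi _ _.
move=> AG DG.
have E : `|scaled_weight j - 2 * h * (peak a * G)| <=
    2 * peak a * local_const a * h ^+ 3.
  have -> : scaled_weight j - 2 * h * (peak a * G) =
      2 * h * peak a / binom_profile n (uphalf n) * (A - binom_profile n (uphalf n) * G).
    by rewrite /scaled_weight -/A; field; rewrite gt_eqF.
  have q0 : 0 < 2 * h * peak a / binom_profile n (uphalf n).
    by rewrite divr_gt0// !mulr_gt0.
  rewrite normrM gtr0_norm// -(ler_pM2l q0) in AG *.
  apply: (le_trans AG); rewrite le_eqVlt; apply/orP; left; apply/eqP.
  by rewrite -hE; field; rewrite gt_eqF.
rewrite /cell_const mulrDl.
have -> : scaled_weight j - D = (scaled_weight j - 2 * h * (peak a * G)) -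
  (D - 2 * h * (peak a * G)) by ring.
by rewrite (le_trans (ler_normB _ _))// lerD.
Qed.

Lemma cell_const_ge0 : 0 <= cell_const.
Proof.
have p0 := peak_gt0 a0.
rewrite addr_ge0 ?mulr_ge0 ?(ltW p0) ?(ltW a0)//.
by rewrite addr_ge0 ?mulr_ge0 ?expR_ge0 ?invr_ge0 ?exprn_ge0 ?(ltW a0).
Qed.

(** The per-cell error [h^3 = h / n] is uniform, and there are at most [n + 1],
    hence at most [2n], cells. *)
Lemma scaled_weight_sum m : (m <= n.+1)%N ->
  `|\sum_(0 <= j < m) scaled_weight j - (Phi a (cell m) - Phi a (cell 0))|
    <= 2 * cell_const * h.
Proof.
move=> mn; rewrite -(telescope_sumr (fun j => Phi a (cell j))) -?sumrB//.
apply: (le_trans (ler_norm_sum _ _ _)).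
apply: (@le_trans _ _ (\sum_(0 <= j < m) cell_const * h ^+ 3)).
  rewrite !big_nat; apply: ler_sum => j /andP[_ jm].
  apply: scaled_weight_cell; lia.
rewrite sumr_const_nat subn0 -[leLHS]mulr_natr.
have c0 := cell_const_ge0.
have -> : 2 * cell_const * h = cell_const * h ^+ 3 * (2 * n%:R).
  by rewrite exprS hE; field; rewrite gt_eqF.
rewrite ler_wpM2l ?mulr_ge0 ?exprn_ge0 ?(ltW h0)// -natrM ler_nat; lia.
Qed.

Definition tail_const : R := peak a / peak (a / 2) * (4 / a).

Lemma tail_const_ge0 : 0 <= tail_const.
Proof.
have p0 := peak_gt0 a0; have a20 : 0 < a / 2 by rewrite divr_gt0.
have p2 := peak_gt0 a20.
by rewrite mulr_ge0// divr_ge0// ltW.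
Qed.

Let U : R := (n%:R + 1) * h.
Let U0 : 0 < U. Proof. by rewrite mulr_gt0// addr_gt0. Qed.
(** In fact [1 / U^2 <= 1 / n = h^2], and [h <= 1]. *)
Let tailU : tail_const / U ^+ 2 <= tail_const * h.
Proof.
rewrite ler_wpM2l ?tail_const_ge0//.
have -> : U ^+ 2 = (n%:R + 1) ^+ 2 / n%:R by rewrite /U exprMn hE.
rewrite invf_div ler_pdivrMr ?exprn_gt0 ?addr_gt0//.
have nE : n%:R = n%:R ^+ 2 * h ^+ 2 :> R by rewrite hE; field; rewrite gt_eqF.
rewrite [leLHS]nE [leRHS]mulrC; apply: ler_pM; rewrite ?exprn_ge0 ?(ltW N0) ?(ltW h0)//.
  by rewrite lerXn2r ?nnegrE ?addr_ge0 ?(ltW N0)// lerDl.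
by rewrite expr2 ger_pMr.
Qed.

Lemma Phi_cell0 : Phi a (cell 0) <= tail_const * h.
Proof.
have -> : cell 0 = - U by rewrite /cell /site /spin_at /U -/h; ring.
exact: le_trans (Phi_lower_tail a0 U0) tailU.
Qed.

Lemma Phi_cell_last : 1 - Phi a (cell n.+1) <= tail_const * h.
Proof.
have -> : cell n.+1 = U by rewrite cellS /site /spin_at /U -/h; ring.
exact: le_trans (Phi_upper_tail a0 U0) tailU.
Qed.

Lemma Phi_shift z : Phi a (z + h) <= Phi a z + peak a * h.
Proof.
have zh : z <= z + h by rewrite lerDl ltW.
have := Phi_lipschitz a0 zh; rewrite addrAC subrr add0r => /ler_normlW; lra.
Qed.

(** The right end of the last cell counted is within [h] of [z], unless [z] lies
    beyond all the cells on one side, where a tail bound takes over. *)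
Lemma Phi_threshold z m : (m <= n.+1)%N ->
  (forall j, (j <= n)%N -> (site n j <= z) = (j < m)%N) ->
  `|Phi a (cell m) - Phi a z| <= (peak a + tail_const) * h.
Proof.
move=> mn zm; have p0 := peak_gt0 a0; have t0 := tail_const_ge0.
have ph : 0 <= peak a * h by rewrite mulr_ge0 ?ltW.
have th : 0 <= tail_const * h by rewrite mulr_ge0 ?(ltW h0).
rewrite mulrDl ler_norml; apply/andP; split.
  move: mn; rewrite leq_eqVlt => /predU1P[->|mn].
    have := Phi_cell_last; have := @Phi_le1 R a z; lra.
  have : z <= cell m + h by rewrite /cell subrK ltW// ltNge zm// ltnn.
  by move/(@Phi_le _ a); have := Phi_shift (cell m); lra.
case: m => [|m] in mn zm *; first by have := Phi_cell0; have := Phi_ge0 a z; lra.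
have : cell m.+1 <= z + h by rewrite cellS lerD2r zm.
by move/(@Phi_le _ a); have := Phi_shift z; lra.
Qed.

Lemma threshold_exists z N :
  exists2 m, (m <= N)%N & forall j, (j < N)%N -> (site n j <= z) = (j < m)%N.
Proof.
elim: N => [|N [m mN Hm]]; first by exists 0%N.
have [zN|zN] := leP (site n N) z.
  exists N.+1 => // j jN; rewrite jN; apply: le_trans zN.
  by rewrite ler_wpM2r ?(ltW h0)// lerD2r ler_pM2l// ler_nat -ltnS.
exists m; first exact: leqW.
move=> j; rewrite ltnS leq_eqVlt => /predU1P[->|]; last exact: Hm.
by rewrite leNgt zN ltnNge mN.
Qed.

Definition rate_const : R :=
  4 * cell_const + 4 * tail_const + peak a.

(** For the scaled weights, partial sums are compared with [Phi] by
    [scaled_weight_sum]; the same comparison for all the cells shows that the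
    normalization is close to [1]. *)
Lemma weight_ratio_Phi z :
  `|(\sum_(j < n.+1 | site n j <= z) cw_weight beta n j) /
    (\sum_(j < n.+1) cw_weight beta n j) - Phi a z| <= rate_const * h.
Proof.
have [m mn zm] := threshold_exists z n.+1.
have q0 : 0 < 2 * h * peak a / binom_profile n (uphalf n).
  by rewrite divr_gt0 ?binom_profile_center_gt0// !mulr_gt0// peak_gt0.
have SE : 2 * h * peak a / binom_profile n (uphalf n) *
    (\sum_(j < n.+1 | site n j <= z) cw_weight beta n j) =
    \sum_(0 <= j < m) scaled_weight j.
  rewrite mulr_sumr big_mkord (big_ord_widen _ scaled_weight mn).
  by apply: eq_bigl => j; rewrite zm.
have WE : 2 * h * peak a / binom_profile n (uphalf n) *
    (\sum_(j < n.+1) cw_weight beta n j) =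
    \sum_(0 <= j < n.+1) scaled_weight j.
  by rewrite mulr_sumr big_mkord.
have W0 : 0 < \sum_(j < n.+1) cw_weight beta n j.
  rewrite big_ord_recl ltr_pwDl ?cw_weight_gt0//.
  by apply: sumr_ge0 => j _; rewrite ltW// cw_weight_gt0// -ltnS.
have S0 : 0 <= \sum_(j < n.+1 | site n j <= z) cw_weight beta n j.
  by apply: sumr_ge0 => j _; rewrite ltW// cw_weight_gt0// -ltnS.
have SW : \sum_(j < n.+1 | site n j <= z) cw_weight beta n j <=
    \sum_(j < n.+1) cw_weight beta n j.
  rewrite [leRHS](bigID (fun j : 'I_n.+1 => site n j <= z))/= lerDl.
  by apply: sumr_ge0 => j _; rewrite ltW// cw_weight_gt0// -ltnS.
have := scaled_weight_sum mn; have := scaled_weight_sum (leqnn n.+1).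
rewrite -SE -WE; have := Phi_threshold mn zm.
have := Phi_cell0; have := Phi_cell_last.
have := Phi_ge0 a (cell 0); have := @Phi_le1 R a (cell n.+1).
set q := 2 * h * peak a / _ in q0 *.
move: W0 S0 SW; set S := \sum_(j < n.+1 | site n j <= z) cw_weight beta n j.
set W := \sum_(j < n.+1) cw_weight beta n j.
move=> W0 S0 SW Pn P0 tn t0; rewrite !ler_distl => /andP[z1 z2] /andP[W1 W2] /andP[S1 S2].
have r0 : 0 <= S / W by rewrite divr_ge0// ltW.
have r1 : S / W <= 1 by rewrite ler_pdivrMr// mul1r.
have SWE : q * S = S / W * (q * W) by field; rewrite gt_eqF.
move: (S / W) (q * W) (q * S) r0 r1 SWE W1 W2 S1 S2 => r w s r0 r1 sE W1 W2 S1 S2.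
(* Now [r] is the probability, [w] the total of the scaled weights, [s = r w]. *)
have rw : `|s - r| <= 2 * cell_const * h + 2 * (tail_const * h).
  have -> : s - r = r * (w - 1) by rewrite sE; ring.
  have w1 : `|w - 1| <= 2 * cell_const * h + 2 * (tail_const * h).
    by rewrite ler_distl; apply/andP; split; lra.
  rewrite normrM (ger0_norm r0); apply: le_trans w1.
  by rewrite ler_piMl.
move: rw; rewrite !ler_distl /rate_const => /andP[rw1 rw2].
apply/andP; split; lra.
Qed.

End fixed_size.
End lattice_comparison.

(** * The law of the total spin *)

Section spin_law.
Context {R : realType}.
Implicit Types (beta z : R) (n : nat) (f : R -> R).

Lemma total_spin_cons n (x : R) (y : n.-tuple R) :
  total_spin (tuple_cons (x, y)) = (x + total_spin y)%R.
Proof.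
rewrite /total_spin big_ord_recl; congr (_ + _)%R.
by apply: eq_bigr => i _; rewrite tnthS.
Qed.

(** Induction on [n], adding one spin: the shifts of [f] by [-1] and [1] recombine
    by Pascal's rule. *)
Lemma integral_total_spin n f : measurable_fun setT f ->
  (forall x, 0 <= f x)%R ->
  \int[power_prob rademacher n]_x (f (total_spin x))%:E =
  (2^-1 ^+ n * \sum_(j < n.+1) 'C(n, j)%:R * f (spin_at n j))%:E.
Proof.
elim: n f => [|n IH] f mf f0.
  have mE : measurable_fun [set: 0.-tuple R] (fun x => (f (total_spin x))%:E).
    by apply/measurable_EFinP; apply: measurableT_comp => //; exact: measurable_total_spin.
  rewrite /= integral_dirac//= diracT mul1e big_ord1 bin0 expr0 !mul1r.
  by rewrite /total_spin big_ord0 /spin_at mulr0 subr0.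
have mE m : measurable_fun [set: m.-tuple R] (fun x => (f (total_spin x))%:E).
  by apply/measurable_EFinP; apply: measurableT_comp => //; exact: measurable_total_spin.
rewrite (ge0_integral_power_probS _ (mE n.+1)); last by move=> x; rewrite lee_fin.
rewrite ge0_integral_rademacher; first last.
- by move=> x; apply: integral_ge0 => y _; rewrite lee_fin.
- have := @measurable_fun_fubini_tonelli_F _ _ _ _ _ (power_prob rademacher n)
    (fun w => (f (total_spin (tuple_cons w)))%:E).
  apply; last by move=> w /=; rewrite lee_fin.
  apply: (measurableT_comp (mE n.+1)); exact: measurable_tuple_cons.
have E (c : R) : \int[power_prob rademacher n]_y
      (f (total_spin (tuple_cons (c, y))))%:E =
    (2^-1 ^+ n * \sum_(j < n.+1) 'C(n, j)%:R * f (c + spin_at n j))%:E.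
  under eq_integral do rewrite total_spin_cons.
  rewrite (IH (fun x => f (c + x)%R))//.
  apply: measurableT_comp => //; exact: measurable_funD.
rewrite !E -!EFinM -EFinD; congr EFin.
rewrite exprS -!mulrA -mulrDr -mulrDr; congr (_ * (_ * _))%R.
have -> : (\sum_(j < n.+1) 'C(n, j)%:R * f (-1 + spin_at n j) =
    \sum_(j < n.+2) 'C(n, j)%:R * f (spin_at n.+1 j))%R.
  rewrite [RHS]big_ord_recr/= bin_small// mul0r addr0.
  apply: eq_bigr => j _; congr (_ * f _)%R.
  by rewrite /spin_at -natr1; ring.
rewrite [in LHS]big_ord_recl [in RHS]big_ord_recl/= !bin0 -addrA; congr (_ + _)%R.
rewrite -big_split/=; apply: eq_bigr => j _.
rewrite binS natrD mulrDl /bump/= add1n; congr (_ + _ * f _)%R.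
by rewrite /spin_at -!natr1; ring.
Qed.

Lemma curie_weiss_cdf beta n z :
  curie_weiss beta [set x : n.-tuple R | (total_spin x / Num.sqrt n%:R <= z)%R] =
  ((\sum_(j < n.+1 | (site n j <= z)%R) cw_weight beta n j) /
    (\sum_(j < n.+1) cw_weight beta n j))%:E.
Proof.
pose e (s : R) := expR (beta / (2 * n%:R) * s ^+ 2).
have me : measurable_fun setT e.
  by apply: measurableT_comp => //; exact: measurable_funM.
pose D := [set s : R | s / Num.sqrt n%:R <= z]%R.
have mD : measurable D.
  have : measurable_fun [set: R] (fun s : R => s / Num.sqrt n%:R)%R.
    exact: measurable_funM.
  move=> /(_ measurableT `]-oo, z]%classic); rewrite setTI; apply => //.
have p2 : (2^-1 ^+ n != 0 :> R)%R by rewrite expf_neq0.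
have ZE : partition_function beta n =
    (2^-1 ^+ n * \sum_(j < n.+1) cw_weight beta n j)%R.
  apply: EFin_inj; rewrite partition_functionE.
  by rewrite (@integral_total_spin n e me)// => x; exact: expR_ge0.
have IE : \int[power_prob rademacher n]_(x in
    [set x : n.-tuple R | (total_spin x / Num.sqrt n%:R <= z)%R])
      (gibbs_density beta x)%:E =
    (2^-1 ^+ n * \sum_(j < n.+1 | (site n j <= z)%R) cw_weight beta n j)%:E.
  rewrite integral_mkcond.
  transitivity (\int[power_prob rademacher n]_x
      ((e \* \1_D) (total_spin x))%:E).
    apply: eq_integral => x _; rewrite patchE /= indicE.
    have -> : (x \in [set x : n.-tuple R | (total_spin x / Num.sqrt n%:R <= z)%R])
        = (total_spin x \in D) by apply/idP/idP => /set_mem h; apply/mem_set.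
    by case: (_ \in D); rewrite ?mulr1// mulr0.
  rewrite (@integral_total_spin n (e \* \1_D)%R).
  - congr (_ * _)%:E; rewrite [RHS]big_mkcond/=; apply: eq_bigr => j _.
    rewrite indicE; have [jz|jz] := boolP (site n j <= z)%R.
      by rewrite mem_set// mulr1.
    by rewrite memNset ?mulr0 ?mulr0//; exact/negP.
  - apply: measurable_funM => //; exact: measurable_indic.
  - by move=> x; rewrite mulr_ge0 ?expR_ge0.
rewrite /curie_weiss IE ZE -EFinM; congr EFin.
by rewrite invfM mulrACA mulVf// mul1r mulrC.
Qed.

End spin_law.

Theorem theorem1p2 (R : realType) (beta : R) (hbeta : (0 < beta < 1)%R) :
  exists C : R, forall n : nat, (1 <= n)%N ->
    ereal_sup [set `| curie_weiss beta
                        [set x : n.-tuple R | (total_spin x / Num.sqrt n%:R <= z)%R]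
                      - normal_cdf ((1 - beta)^-1) z | | z in [set: R]]
      <= (C / Num.sqrt n%:R)%:E.
Proof.
have /andP[_ beta1] := hbeta.
exists (rate_const beta) => n n_gt0; apply: ge_ereal_sup => _ [z _ <-].
by rewrite curie_weiss_cdf normal_cdfE -EFinB lee_fin weight_ratio_Phi.
Qed.
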